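(* Let $d_0\ge 2$ be an integer and $\varepsilon>0$. Then $$\lim_{|G|\to\infty,\ \deg(G)\le d_0}\ \inf_{x\in G\times\{0\}} P_x\big[\mathcal{T}_G\le \mathcal{C}_G\le |G|^2(\log|G|)^{4+\varepsilon}\big]=1 ,$$ where the limit is over finite connected graphs $G$ with $|G|\geq 2$ and $\deg(G)\le d_0$, uniformly as $|G|\to\infty$ (for every $\eta>0$ there is $n_0$ such that for all such $G$ with $|G|\ge n_0$ the infimum is at least $1-\eta$).
   Context: $G$ denotes a finite connected (simple, undirected) graph, identified with its vertex set; $|G|$ is its number of vertices and $\deg(G)$ the maximal number of neighbors of a vertex. The discrete cylinder $E=G\times\mathbb{Z}$ carries the product graph structure: $(g,u)$ and $(g',u')$ are neighbors iff either $g=g'$ and $|u-u'|=1$, or $u=u'$ and $g,g'$ are neighbors in $G$. For $x\in E$, $P_x$ is the law of the discrete-time simple random walk $(X_n)_{n\ge0}$ on $E$ starting at $x$ (at each step it jumps to a uniformly chosen neighbor). A finite set $S\subseteq E$ disconnects $E$ if for large $M$ the sets $G\times[M,\infty)$ and $G\times(-\infty,-M]$ are contained in two distinct connected components of $E\setminus S$. The disconnection time is $\mathcal{T}_G=\inf\{n\ge0: X_{[0,n]}\text{ disconnects }E\}$, where $X_{[0,n]}=\{X_0,\dots,X_n\}$. $\mathcal{C}_G$ is the cover time of $G\times\{0\}$ by $X$, i.e. the first time $n$ such that $G\times\{0\}\subseteq X_{[0,n]}$. *)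

(* Defs.v *)
From HB Require Import structures.
From mathcomp Require Import all_boot all_order all_algebra finmap.
From mathcomp Require Import all_classical all_reals all_analysis.

Set Implicit Arguments.
Unset Strict Implicit.
Unset Printing Implicit Defensive.

Import Order.TTheory GRing.Theory Num.Theory.

Local Open Scope classical_set_scope.
Local Open Scope ring_scope.

Definition connected_graph (V : finType) (e : rel V) : Prop :=
  forall x y : V, connect e x y.

Definition max_degree (V : finType) (e : rel V) : nat :=
  (\max_(x : V) #|[pred y | e x y]|)%N.

(* Possibly infinite graphs, given by an adjacency relation [e]. *)

(* [a] and [b] are joined by a path of the subgraph induced on [A]. *)
Definition joined_in (E : eqType) (e : rel E) (A : set E) (a b : E) : Prop :=
  exists p : seq E, [/\ path e a p, last a p = b
                      & forall z, z \in a :: p -> A z].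

Definition is_component (E : eqType) (e : rel E) (A C : set E) : Prop :=
  exists2 a, A a & C = [set b | joined_in e A a b].

(* [fset_set] is the empty set on infinite sets: meaningful for locally finite
   graphs only (see [cyl_neighbors_finite]). *)
Definition num_neighbors (E : choiceType) (e : rel E) (x : E) : nat :=
  #|` fset_set [set y | e x y]|%fset.

Definition srw_step (R : realType) (E : choiceType) (e : rel E) (x y : E) : R :=
  if e x y then (num_neighbors e x)%:R^-1 else 0.

(* Under [P], the process [X] is the simple random walk started at [x]: each
   [X n] is a random variable for the discrete sigma-algebra on [E], and the
   finite-dimensional distributions are those of the Markov chain. *)
Definition is_srw (R : realType) (E : choiceType) (e : rel E) (x : E)
    (d : measure_display) (Omega : measurableType d) (P : probability Omega R)
    (X : nat -> Omega -> E) : Prop :=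
  (forall (n : nat) (A : set E), measurable (X n @^-1` A)) /\
  (forall (n : nat) (s : nat -> E),
     P [set w | forall i, (i <= n)%N -> X i w = s i]
     = ((s 0%N == x)%:R * \prod_(i < n) srw_step R e (s i) (s i.+1))%:E).

(* Range of the trajectory [x] up to time [n]. *)
Definition trace (E : Type) (x : nat -> E) (n : nat) : set E :=
  [set x i | i in [set i | (i <= n)%N]].

(* First time in [A], with value [+oo] if there is none. *)
Definition first_time (R : realType) (A : set nat) : \bar R :=
  ereal_inf [set (n%:R)%:E | n in A].

Section Cylinder.
Variables (V : finType) (e : rel V).

Definition cyl_adj : rel (V * int) := fun x y =>
  ((x.1 == y.1) && (`|x.2 - y.2| == 1)) || ((x.2 == y.2) && e x.1 y.1).

Definition disconnects (S : set (V * int)) : Prop :=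
  exists M0 : int, forall M : int, M0 <= M ->
    exists C1 C2 : set (V * int),
      [/\ is_component cyl_adj (~` S) C1, is_component cyl_adj (~` S) C2,
          C1 <> C2,
          [set x | M <= x.2] `<=` C1 & [set x | x.2 <= - M] `<=` C2].

Definition level0 : set (V * int) := [set x | x.2 = 0].

Definition disconnection_time (R : realType) (x : nat -> V * int) : \bar R :=
  first_time R [set n | disconnects (trace x n)].

Definition cover_time (R : realType) (x : nat -> V * int) : \bar R :=
  first_time R [set n | level0 `<=` trace x n].

Let nbrs (x : V * int) : seq (V * int) :=
  [:: (x.1, x.2 + 1), (x.1, x.2 - 1)
    & [seq (v, x.2) | v <- enum [pred v | e x.1 v]]].

Let nbrsE x : [set y | cyl_adj x y] = [set` nbrs x].
Proof.
apply/seteqP; split => -[v u] /=; rewrite /cyl_adj /= !inE.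
- case/orP => /andP[].
    move=> /eqP <-; rewrite !xpair_eqE !eqxx /= eqr_norml ler01 andbT.
    case/orP => /eqP h.
    + by rewrite -h subKr eqxx orbT.
    + by rewrite -[1]opprK -h subKr eqxx.
  move=> /eqP <- h; apply/orP; right; apply/orP; right.
  by apply/mapP; exists v; rewrite // mem_enum inE.
- case/or3P => [/eqP[-> ->]|/eqP[-> ->]|/mapP[v' + [-> ->]]].
  + by rewrite eqxx opprD addNKr normrN1.
  + by rewrite eqxx opprB addrC subrK normr1.
  + by rewrite mem_enum inE => ->; rewrite eqxx orbT.
Qed.

Lemma cyl_neighbors_finite (x : V * int) : finite_set [set y | cyl_adj x y].
Proof. by rewrite nbrsE; exact: finite_seq. Qed.

Lemma cyl_num_neighbors (x : V * int) :
  num_neighbors cyl_adj x = (#|[pred v | e x.1 v]| + 2)%N.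
Proof.
have un : uniq (nbrs x).
  rewrite /= !inE; apply/and3P; split.
  - apply/norP; split; first by rewrite xpair_eqE eqxx /= (inj_eq (addrI _)).
    by apply/negP => /mapP[v _ [_ /eqP]]; rewrite -subr_eq0 addrC addKr.
  - by apply/negP => /mapP[v _ [_ /eqP]]; rewrite -subr_eq0 addrC addKr.
  - by rewrite map_inj_uniq ?enum_uniq // => v1 v2 [].
have -> : num_neighbors cyl_adj x = size (nbrs x).
  rewrite /num_neighbors nbrsE.
  have -> : fset_set [set` nbrs x] = [fset y in nbrs x]%fset.
    apply/fsetP => y; rewrite in_fset_set; last exact: finite_seq.
    by rewrite in_fset /=; apply/idP/idP; rewrite in_setE.
  by rewrite card_fseq undup_id.
by rewrite /= size_map -cardE addn2.
Qed.

End Cylinder.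

(* Main.v *)
Require Import Defs.
From HB Require Import structures.
From mathcomp Require Import all_boot all_order all_algebra.
From mathcomp Require Import all_classical all_reals all_analysis.
From mathcomp Require Import ring lra zify.

(* Once level 0 is covered the trace separates the two ends, so T_G <= C_G
   always holds, and only an upper bound on C_G is needed.

   Let N = |G|.  The effective resistance in G x Z between two points of level 0
   is O(log N): a simple path of G times Z is a strip of the planar grid.
   By the commute time argument, the expected number of visits to level 0
   before a given point y of level 0 is hit is therefore at most
   M = O(d_0 N log N), with no appeal to mixing on G; iterating, y is missed
   during l visits with probability at most 2 (1 - 1/(2M))^l.  This is o(1/N)
   for l = N (log N)^2 lam with lam = (log N)^(eps/6), so a union bound over y
   applies.  Finally, l visits occur by time N^2 (log N)^4 lam^6 with high
   probability: the walk leaves |u| < H = N (log N)^2 lam^2 by that time, and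
   from level 0 it returns there about H times before leaving. *)

Set Implicit Arguments.
Unset Strict Implicit.
Unset Printing Implicit Defensive.

Import Order.TTheory GRing.Theory Num.Theory.

Local Open Scope classical_set_scope.
Local Open Scope ring_scope.

(** * Resistance of a planar grid *)

Section GridResistance.
Variable R : realFieldType.

(** Cauchy-Schwarz, with [w] in the part of resistances and [b] of energies; the product form of the
    hypothesis avoids dividing by [w k]. *)
Lemma sqr_sum_le (n : nat) (x w b : nat -> R) :
  (forall k, (k < n)%N -> [/\ 0 <= w k, 0 <= b k & x k ^+ 2 <= w k * b k]) ->
  (\sum_(k < n) x k) ^+ 2 <= (\sum_(k < n) w k) * (\sum_(k < n) b k).
Proof.
elim: n => [|n IHn] H; first by rewrite !big_ord0 expr0n /= mulr0.
have {}IHn := IHn (fun k kn => H k (ltnW kn)).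
have [wn bn xn] := H n (ltnSn n).
rewrite !big_ord_recr /=.
have W0 : 0 <= \sum_(k < n) w k.
  by apply: sumr_ge0 => k _; case: (H k (ltnW (ltn_ord k))).
have B0 : 0 <= \sum_(k < n) b k.
  by apply: sumr_ge0 => k _; case: (H k (ltnW (ltn_ord k))).
move: W0 B0 IHn wn bn xn.
move: (\sum_(k < n) x k) (\sum_(k < n) w k) (\sum_(k < n) b k) (x n) (w n) (b n).
move=> S W B d v c W0 B0 SWB v0 c0 dvc.
(* Compare squares: 4 S^2 d^2 <= 4 (W B) (v c) <= (W c + v B)^2. *)
have cross : S * d *+ 2 <= W * c + v * B.
  apply: (@le_trans _ _ `|S * d *+ 2|); first exact: ler_norm.
  rewrite -[leRHS]ger0_norm ?addr_ge0 ?mulr_ge0 // -ler_sqr ?nnegrE //.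
  rewrite !real_normK ?num_real //.
  have h : S ^+ 2 * d ^+ 2 <= (W * B) * (v * c).
    by apply: ler_pM; rewrite ?sqr_ge0.
  have := sqr_ge0 (W * c - v * B); nra.
nra.
Qed.

Definition diag_mean (F : nat -> nat -> R) (k : nat) : R :=
  k.+1%:R^-1 * \sum_(i < k.+1) F i (k - i)%N.

Definition out_energy (F : nat -> nat -> R) (i j : nat) : R :=
  (F i.+1 j - F i j) ^+ 2 + (F i j.+1 - F i j) ^+ 2.

(* The unit flow that is uniform on each antidiagonal [i + j = k]: mass at
   [(i, j)] moves right with probability [(i + 1) / (k + 2)], up otherwise,
   as in Polya's urn. *)
Lemma diag_mean_step (F : nat -> nat -> R) (k : nat) :
  diag_mean F k.+1 - diag_mean F k =
  \sum_(i < k.+1)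
    ((i.+1%:R / (k.+1%:R * k.+2%:R)) * (F i.+1 (k - i)%N - F i (k - i)%N) +
     ((k - i).+1%:R / (k.+1%:R * k.+2%:R)) * (F i (k - i).+1 - F i (k - i)%N)).
Proof.
have k1 : k.+1%:R != 0 :> R by rewrite pnatr_eq0.
have k2 : k.+2%:R != 0 :> R by rewrite pnatr_eq0.
set c := (k.+1%:R * k.+2%:R)^-1.
have -> : diag_mean F k = \sum_(i < k.+1) (k.+2%:R * c) * F i (k - i)%N.
  rewrite /diag_mean mulr_sumr; apply: eq_bigr => i _; congr (_ * _).
  by rewrite /c invfM mulrCA mulfV ?mulr1.
have -> : diag_mean F k.+1 =
    \sum_(i < k.+1) ((i.+1%:R * c) * F i.+1 (k - i)%N +
                     ((k - i).+1%:R * c) * F i (k - i).+1).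
  (* Since [i + (k + 1 - i) = k + 1], the weight of each point splits into the mass arriving from
     its left and from below; the missing neighbors at the two ends get weight 0. *)
  have -> : diag_mean F k.+1 =
     \sum_(i < k.+2) (i%:R * c) * F i (k.+1 - i)%N +
     \sum_(i < k.+2) ((k.+1 - i)%:R * c) * F i (k.+1 - i)%N.
    rewrite /diag_mean mulr_sumr -big_split /=; apply: eq_bigr => i _.
    rewrite -mulrDl -mulrDl -natrD subnKC; last by rewrite -ltnS.
    by rewrite /c invfM mulrA mulfV ?mul1r.
  rewrite big_ord_recl /= !mul0r add0r.
  rewrite [X in _ + X]big_ord_recr /= subnn !mul0r addr0.
  rewrite -big_split /=; apply: eq_bigr => i _.
  by rewrite subSS subSn // -ltnS.
rewrite -sumrB; apply: eq_bigr => i _.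
have -> : k.+2%:R = i.+1%:R + (k - i).+1%:R :> R.
  by rewrite -natrD; congr _%:R; have := ltn_ord i; lia.
ring.
Qed.

(** Each term of the flow has the form [p * a + q * b] with [p + q = 1 / (k + 1)]. Cauchy-Schwarz
    over the [k + 1] points then leaves the factor [(k + 1) / (k + 1)^2]. *)
Lemma sqr_diag_mean_step (F : nat -> nat -> R) (k : nat) :
  (diag_mean F k.+1 - diag_mean F k) ^+ 2 <=
  k.+1%:R^-1 * \sum_(i < k.+1) out_energy F i (k - i)%N.
Proof.
rewrite diag_mean_step.
set G := (G in (\sum_(i < _) G i) ^+ 2 <= _).
have k1 : 0 < k.+1%:R :> R by rewrite ltr0n.
have k2 : 0 < k.+2%:R :> R by rewrite ltr0n.
pose u (i : nat) : R := 
  ((i.+1%:R / (k.+1%:R * k.+2%:R)) * (F i.+1 (k - i)%N - F i (k - i)%N) +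
     ((k - i).+1%:R / (k.+1%:R * k.+2%:R)) * (F i (k - i).+1 - F i (k - i)%N)).
apply: (le_trans (@sqr_sum_le k.+1 u (fun=> 1)
   (fun i => k.+1%:R^-2 * out_energy F i (k - i)%N) _)).
  move=> i ik; split => //.
    by rewrite mulr_ge0 ?invr_ge0 ?exprn_ge0 // addr_ge0 ?sqr_ge0.
  rewrite mul1r /u /out_energy.
  set p := _ / _; set q := _ / _; set a := _ - _; set b := _ - _.
  have p0 : 0 <= p by rewrite divr_ge0 // mulr_ge0.
  have q0 : 0 <= q by rewrite divr_ge0 // mulr_ge0.
  have pq : p + q = k.+1%:R^-1.
    rewrite /p /q -mulrDl -natrD.
    have -> : (i.+1 + (k - i).+1)%N = k.+2 by lia.
    by rewrite invfM mulrCA mulfV ?mulr1 // gt_eqF.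
  rewrite -exprVn -pq.
  have : 0 <= (p * b - q * a) ^+ 2 by exact: sqr_ge0.
  have : 0 <= p * q by exact: mulr_ge0.
  have := sqr_ge0 a; have := sqr_ge0 b; nra.
rewrite -mulr_sumr sumr_const card_ord mulrA -[1 *+ _]/(k.+1%:R).
by rewrite expr2 invfM mulrA divff ?mul1r // gt_eqF.
Qed.

(** Successive antidiagonals act as resistances [1 / (k + 1)] in series, which is the source of the
    logarithm. The triangle [i + j < D] is then enlarged to a square. *)
Lemma sqr_diag_mean_le (F : nat -> nat -> R) (D : nat) :
  (diag_mean F D - F 0%N 0%N) ^+ 2 <=
  (\sum_(k < D) k.+1%:R^-1) * \sum_(i < D) \sum_(j < D) out_energy F i j.
Proof.
have out0 i j : 0 <= out_energy F i j by rewrite addr_ge0 ?sqr_ge0.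
have mean0 : diag_mean F 0 = F 0%N 0%N.
  by rewrite /diag_mean invr1 mul1r big_ord1.
have -> : diag_mean F D - F 0%N 0%N =
    \sum_(k < D) (diag_mean F k.+1 - diag_mean F k).
  elim: D => [|D IHD]; first by rewrite big_ord0 mean0 subrr.
  by rewrite big_ord_recr /= -IHD addrC addrA subrK.
apply: (le_trans (@sqr_sum_le D (fun k => diag_mean F k.+1 - diag_mean F k)
   (fun k => k.+1%:R^-1)
   (fun k => \sum_(i < k.+1) out_energy F i (k - i)%N) _)).
  move=> k kD; split; [by rewrite invr_ge0| |exact: sqr_diag_mean_step].
  by apply: sumr_ge0.
apply: ler_wpM2l; first by apply: sumr_ge0 => k _; rewrite invr_ge0.
have -> : \sum_(k < D) \sum_(i < k.+1) out_energy F i (k - i)%N =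
    \sum_(k < D) \sum_(i < D | (i <= k)%N) out_energy F i (k - i)%N.
  apply: eq_bigr => k _.
  by rewrite (big_ord_widen D (fun i => out_energy F i (k - i)%N)).
rewrite (exchange_big_dep predT) //=.
apply: ler_sum => i _.
have -> : \sum_(k < D | (i <= k)%N) out_energy F i (k - i)%N =
    \sum_(j < D - i) out_energy F i j.
  rewrite -(big_mkord (fun k => (i <= k)%N) (fun k => out_energy F i (k - i)%N)).
  rewrite (big_cat_nat _ (n := i)) //=; last exact: ltnW.
  rewrite big_nat_cond big1 ?add0r; last by move=> k /andP[]; lia.
  rewrite -{1}(add0n i) big_addn big_mkord; apply: eq_big => [j|j _].
    by rewrite leq_addl.
  by rewrite addnK.
rewrite (big_ord_widen D (out_energy F i)) ?leq_subr //.
rewrite big_mkcond /=; apply: ler_sum => j _.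
by case: ifP.
Qed.

(** Horizontal edges of the top row [j = D] are left out, but all [D + 1] columns are kept, so that
    the reflection of [i] into [D - i] preserves the energy. *)
Definition grid_energy (F : nat -> nat -> R) (D : nat) : R :=
  \sum_(j < D) (\sum_(i < D) (F i.+1 j - F i j) ^+ 2 +
                \sum_(i < D.+1) (F i j.+1 - F i j) ^+ 2).

Lemma grid_energy_ge0 (F : nat -> nat -> R) (D : nat) : 0 <= grid_energy F D.
Proof.
by apply: sumr_ge0 => j _; rewrite addr_ge0 // sumr_ge0 // => i _; exact: sqr_ge0.
Qed.

Lemma out_energy_le_grid (F : nat -> nat -> R) (D : nat) :
  \sum_(i < D) \sum_(j < D) out_energy F i j <= grid_energy F D.
Proof.
rewrite exchange_big /=; apply: ler_sum => j _.
rewrite big_split /= lerD2l big_ord_recr /= lerDl; exact: sqr_ge0.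
Qed.

Lemma grid_energy_rev (F : nat -> nat -> R) (D : nat) :
  grid_energy (fun i j => F (D - i)%N j) D = grid_energy F D.
Proof.
apply: eq_bigr => j _; congr (_ + _); rewrite (reindex_inj rev_ord_inj) /=.
  apply: eq_bigr => i _; have iD := ltn_ord i.
  have -> : (D - (D - i.+1).+1 = i)%N by lia.
  have -> : (D - (D - i.+1) = i.+1)%N by lia.
  by rewrite -opprB sqrrN.
apply: eq_bigr => i _; have iD := ltn_ord i.
by have -> : (D - (D.+1 - i.+1) = i)%N by lia.
Qed.

Lemma sqr_column_le (f : nat -> R) (D a b : nat) :
  (a <= D)%N -> (b <= D)%N ->
  (f a - f b) ^+ 2 <= D%:R * \sum_(j < D) (f j.+1 - f j) ^+ 2.
Proof.
wlog ab : a b / (a <= b)%N => [H aD bD|_ bD].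
  by case: (leqP a b) => [/H|/ltnW/H] => [|h]; [exact|rewrite -sqrrN opprB; exact: h].
have -> : f a - f b = \sum_(j < D) (if (a <= j < b)%N then f j - f j.+1 else 0).
  rewrite -(big_mkord predT (fun j => if (a <= j < b)%N then f j - f j.+1 else 0)).
  apply: esym; rewrite (big_cat_nat _ (n := a)) ?(leq_trans ab) //=.
  rewrite [X in _ + X](big_cat_nat _ (n := b)) //=.
  rewrite big_nat_cond big1 ?add0r; last by move=> k /andP[? _]; case: ifP => //; lia.
  rewrite [X in _ + X]big_nat_cond [X in _ + X]big1 ?addr0; last first.
    by move=> k /andP[? _]; case: ifP => //; lia.
  rewrite (eq_big_nat _ _ (F2 := fun k => - (f k.+1 - f k))); last first.
    by move=> k ->; rewrite opprB.
  by rewrite sumrN telescope_sumr // opprB.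
apply: (le_trans (@sqr_sum_le D (fun j => if (a <= j < b)%N then f j - f j.+1 else 0)
   (fun=> 1) (fun j => (f j.+1 - f j) ^+ 2) _)).
  move=> k _; split; rewrite ?sqr_ge0 // mul1r.
  by case: ifP => _; [rewrite -sqrrN opprB|rewrite expr0n sqr_ge0].
by rewrite sumr_const card_ord.
Qed.

(** The reflected mean runs over the diagonal [(i, i)]. Both means give each column weight
    [1 / (D + 1)], so they are compared column by column along vertical edges, at bounded cost. *)
Lemma sqr_diag_gap (F : nat -> nat -> R) (D : nat) :
  (diag_mean F D - diag_mean (fun i j => F (D - i)%N j) D) ^+ 2 <= grid_energy F D.
Proof.
have -> : diag_mean (fun i j => F (D - i)%N j) D =
    D.+1%:R^-1 * \sum_(i < D.+1) F i i.
  congr (_ * _); rewrite (reindex_inj rev_ord_inj) /=; apply: eq_bigr => i _.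
  by have -> : (D - (D.+1 - i.+1) = i)%N by have := ltn_ord i; lia.
rewrite -mulrBr -sumrB exprMn.
pose col (i : nat) := \sum_(j < D) (F i j.+1 - F i j) ^+ 2.
have col0 i : 0 <= col i by apply: sumr_ge0 => j _; exact: sqr_ge0.
have gap : (\sum_(i < D.+1) (F i (D - i)%N - F i i)) ^+ 2 <=
    D.+1%:R ^+ 2 * \sum_(i < D.+1) col i.
  apply: (le_trans (@sqr_sum_le D.+1 (fun i => F i (D - i)%N - F i i) (fun=> 1)
    (fun i => D.+1%:R * col i) _)).
    move=> i iD; split=> //; first by rewrite mulr_ge0.
    rewrite mul1r; apply: (le_trans (@sqr_column_le (F i) D _ _ (leq_subr _ _) _)) => //.
    by apply: ler_wpM2r; [exact: col0|rewrite ler_nat].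
  by rewrite sumr_const card_ord -mulr_sumr mulrA.
apply: (@le_trans _ _ (\sum_(i < D.+1) col i)).
  rewrite exprVn -ler_pdivlMl ?invr_gt0 ?exprn_gt0 ?ltr0n // invrK.
  exact: gap.
rewrite exchange_big /=; apply: ler_sum => j _.
by rewrite lerDr sumr_ge0 // => i _; exact: sqr_ge0.
Qed.

(** Go from the corner [(0, 0)] to the mean on the antidiagonal, along columns to the mean on the
    diagonal, and by reflection to the corner [(D, 0)]. The factor 3 comes from squaring a sum of
    three differences. *)
Lemma grid_resistance (F : nat -> nat -> R) (D : nat) :
  (F 0%N 0%N - F D 0%N) ^+ 2 <=
  3 * (2 * \sum_(k < D) k.+1%:R^-1 + 1) * grid_energy F D.
Proof.
pose F' i j := F (D - i)%N j.
have S0 : 0 <= \sum_(k < D) k.+1%:R^-1 :> R.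
  by apply: sumr_ge0 => k _; rewrite invr_ge0.
have h1 := le_trans (sqr_diag_mean_le F D) (ler_wpM2l S0 (out_energy_le_grid F D)).
have h2 := le_trans (sqr_diag_mean_le F' D) (ler_wpM2l S0 (out_energy_le_grid F' D)).
have h3 := sqr_diag_gap F D.
rewrite grid_energy_rev {2}/F' subn0 in h2.
move: h1 h2 h3; rewrite -/F'.
move: (diag_mean F D) (diag_mean F' D) (F 0%N 0%N) (F D 0%N) => p q a b.
move: (\sum_(k < D) _) (grid_energy F D) => s E h1 h2 h3.
have : (a - b) ^+ 2 <= 3 * ((p - a) ^+ 2 + (p - q) ^+ 2 + (q - b) ^+ 2).
  have := sqr_ge0 ((a - p) - (p - q)); have := sqr_ge0 ((p - q) - (q - b)).
  have := sqr_ge0 ((a - p) - (q - b)); nra.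
nra.
Qed.
End GridResistance.

(** * Green functions and resistance on the cylinder *)

Section DirichletForm.
Variable R : realFieldType.

Lemma summation_by_parts (phi : nat -> R) (K : nat) :
  \sum_(k < K) phi k.+1 * (2 * phi k.+1 - phi k.+2 - phi k) =
  \sum_(k < K.+1) (phi k.+1 - phi k) ^+ 2
  + phi 0%N * (phi 1%N - phi 0%N) - phi K.+1 * (phi K.+1 - phi K).
Proof.
elim: K => [|K IHK]; first by rewrite big_ord0 big_ord1; ring.
by rewrite big_ord_recr IHK [in RHS]big_ord_recr /=; ring.
Qed.

Lemma sum_shift_le (h : nat -> R) (b D K : nat) :
  (forall k, 0 <= h k) -> (b + D <= K)%N ->
  \sum_(j < D) h (b + j)%N <= \sum_(k < K) h k.
Proof.
move=> h0 bDK; rewrite -(big_mkord predT h).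
rewrite (big_cat_nat _ (n := b)) //=; last by lia.
rewrite [X in _ <= _ + X](big_cat_nat _ (n := (b + D)%N)) ?leq_addr //=.
have -> : \sum_(b <= k < b + D) h k = \sum_(j < D) h (b + j)%N.
  rewrite -{1}(add0n b) big_addn addKn big_mkord.
  by apply: eq_bigr => j _; rewrite addnC.
by rewrite addrCA lerDl addr_ge0 // sumr_ge0.
Qed.

Variables (V : finType) (e : rel V).
Hypothesis e_sym : symmetric e.

Lemma sum_inj_le (x : nat -> V) (D : nat) (h : V -> R) :
  (forall i j, (i < D)%N -> (j < D)%N -> x i = x j -> i = j) ->
  (forall v, 0 <= h v) -> \sum_(i < D) h (x i) <= \sum_v h v.
Proof.
move=> x_inj h0; pose xo (i : 'I_D) := x i.
have := @big_imset R 0 +%R _ _ xo (mem [set: 'I_D]%SET) h.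
rewrite [X in _ -> _ = X](eq_bigl predT); last by move=> i; rewrite inE.
move=> <-; last by move=> i j _ _ /x_inj h'; apply/val_inj/h'.
by rewrite big_mkcond; apply: ler_sum => v _; case: ifP.
Qed.

(** Symmetrize in [v] and [w]; the factor 1/2 reflects that each edge is summed in both
    orientations. *)
Lemma graph_dirichlet (g : V -> R) :
  \sum_v \sum_(w | e v w) g v * (g v - g w) =
  2^-1 * \sum_v \sum_(w | e v w) (g v - g w) ^+ 2.
Proof.
have E : \sum_v \sum_(w | e v w) g v * (g v - g w) =
         \sum_v \sum_(w | e v w) g w * (g w - g v).
  rewrite (exchange_big_dep predT) //=; apply: eq_bigr => v _.
  by apply: eq_bigl => w; rewrite e_sym.
have -> : \sum_v \sum_(w | e v w) (g v - g w) ^+ 2 =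
    \sum_v \sum_(w | e v w) g v * (g v - g w) +
    \sum_v \sum_(w | e v w) g w * (g w - g v).
  rewrite -big_split; apply: eq_bigr => v _; rewrite -big_split.
  by apply: eq_bigr => w _ /=; ring.
by rewrite -E; field.
Qed.

Definition deg (v : V) : nat := #|[pred w | e v w]|.

Lemma deg_le (d : nat) (v : V) : (max_degree e <= d)%N -> (deg v <= d)%N.
Proof.
apply: leq_trans.
exact: (leq_bigmax (F := fun v => #|[pred w | e v w]|) v).
Qed.

(** The transition operator of the walk. *)
Definition avg (f : V * int -> R) (x : V * int) : R :=
  (f (x.1, x.2 + 1) + f (x.1, x.2 - 1) + \sum_(v | e x.1 v) f (v, x.2))
  / (deg x.1 + 2)%:R.

(** The function times its graph Laplacian; for finite support the sum over all points is the
    Dirichlet energy. *)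
Definition flux (f : V * int -> R) (x : V * int) : R :=
  (deg x.1 + 2)%:R * f x * (f x - avg f x).

Lemma fluxE (f : V * int -> R) (v : V) (u : int) :
  flux f (v, u) =
  f (v, u) * (2 * f (v, u) - f (v, u + 1) - f (v, u - 1)) +
  \sum_(w | e v w) f (v, u) * (f (v, u) - f (w, u)).
Proof.
rewrite /flux /avg /= -mulr_sumr sumrB sumr_const.
have m0 : (deg v + 2)%:R != 0 :> R by rewrite pnatr_eq0 addn2.
have -> : (deg v + 2)%:R * f (v, u) = f (v, u) * (deg v + 2)%:R by rewrite mulrC.
rewrite -mulrA mulrBr [_ * (_ / _)]mulrCA mulfV // mulr1 natrD -mulr_natl.
by rewrite /deg; ring.
Qed.

(** The simple path [x] times the levels from 0 to [D] is a grid embedded in the cylinder, so its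
    energy is part of the total one, which the fluxes add up to. *)
Lemma cyl_energy_le (f : V * int -> R) (b : nat) (x : nat -> V) (D : nat) :
  (forall v u, (b < `|u|)%N -> f (v, u) = 0) ->
  (forall i j, (i <= D)%N -> (j <= D)%N -> x i = x j -> i = j) ->
  (forall i, (i < D)%N -> e (x i) (x i.+1)) -> (D <= b)%N ->
  grid_energy (fun i j => f (x i, j%:Z)) D <=
  2 * \sum_(k < (b + b).+1) \sum_v flux f (v, k%:Z - b%:Z).
Proof.
move=> f0 x_inj x_path Db.
(* The shift by [b + 1] puts the indices 0 and [2 b + 2] just outside the support, so the boundary
   terms of the summation by parts vanish. *)
pose phi v k := f (v, k%:Z - b.+1%:Z).
have phi_flux v k : f (v, k%:Z - b%:Z) = phi v k.+1.
  by rewrite /phi; congr (f (_, _)); lia.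
pose ver (k : nat) := \sum_v (phi v k.+1 - phi v k) ^+ 2.
pose hor (k : nat) := \sum_v \sum_(w | e v w) (phi v k.+1 - phi w k.+1) ^+ 2.
have ver0 k : 0 <= ver k by apply: sumr_ge0 => v _; exact: sqr_ge0.
have hor0 k : 0 <= hor k.
  by apply: sumr_ge0 => v _; apply: sumr_ge0 => w _; exact: sqr_ge0.
have -> : \sum_(k < (b + b).+1) \sum_v flux f (v, k%:Z - b%:Z) =
    \sum_(k < (b + b).+2) ver k + 2^-1 * \sum_(k < (b + b).+1) hor k.
  pose vf v k := phi v k.+1 * (2 * phi v k.+1 - phi v k.+2 - phi v k).
  transitivity (\sum_(k < (b + b).+1) (\sum_v vf v k + 2^-1 * hor k)).
    apply: eq_bigr => k _; rewrite -graph_dirichlet -big_split; apply: eq_bigr => v _.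
    rewrite fluxE phi_flux /vf; congr (_ * (_ - _ - _) + _).
    - by rewrite /phi; congr (f (_, _)); lia.
    - by rewrite /phi; congr (f (_, _)); lia.
    - by apply: eq_bigr => w _; rewrite phi_flux.
  rewrite big_split /= -mulr_sumr; congr (_ + _).
  rewrite exchange_big /ver [RHS]exchange_big /=; apply: eq_bigr => v _.
  rewrite summation_by_parts.
  have -> : phi v 0%N = 0 by apply: f0; lia.
  have -> : phi v (b + b).+2 = 0 by apply: f0; lia.
  by rewrite !mul0r addr0 subr0.
have le_ver : \sum_(j < D) \sum_(i < D.+1) (f (x i, j.+1%:Z) - f (x i, j%:Z)) ^+ 2
    <= \sum_(k < (b + b).+2) ver k.
  apply: (le_trans _ (@sum_shift_le ver b.+1 D _ ver0 _)); last by lia.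
  apply: ler_sum => j _.
  apply: (le_trans _ (@sum_inj_le x D.+1
    (fun v => (phi v (b.+1 + j).+1 - phi v (b.+1 + j)%N) ^+ 2) _ _)).
  - rewrite le_eqVlt; apply/orP; left; apply/eqP; apply: eq_bigr => i _.
    by congr ((_ - _) ^+ 2); rewrite /phi; congr (f (_, _)); lia.
  - by move=> i i' iD i'D; apply: x_inj.
  - by move=> v; exact: sqr_ge0.
have le_hor : \sum_(j < D) \sum_(i < D) (f (x i.+1, j%:Z) - f (x i, j%:Z)) ^+ 2
    <= \sum_(k < (b + b).+1) hor k.
  apply: (le_trans _ (@sum_shift_le hor b D _ hor0 _)); last by lia.
  apply: ler_sum => j _.
  pose h v := \sum_(w | e v w) (phi v (b + j).+1 - phi w (b + j).+1) ^+ 2.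
  apply: (le_trans _ (@sum_inj_le x D h _ _)).
  - apply: ler_sum => i _; rewrite /h (bigD1 (x i.+1)) ?x_path //=.
    have phiE k : phi (x k) (b + j).+1 = f (x k, j%:Z).
      by rewrite /phi; congr (f (_, _)); lia.
    by rewrite !phiE -sqrrN opprB lerDl sumr_ge0 // => w _; exact: sqr_ge0.
  - by move=> i i' iD i'D; apply: x_inj; exact: ltnW.
  - by move=> v; apply: sumr_ge0 => w _; exact: sqr_ge0.
have ver_tot : 0 <= \sum_(k < (b + b).+2) ver k by apply: sumr_ge0.
rewrite /grid_energy big_split /=; lra.
Qed.

Lemma connected_path (z y : V) : connect e z y ->
  exists (x : nat -> V) (D : nat), [/\ x 0%N = z, x D = y, (D < #|V|)%N,
    forall i j, (i <= D)%N -> (j <= D)%N -> x i = x j -> i = j &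
    forall i, (i < D)%N -> e (x i) (x i.+1)].
Proof.
case/connectP => p0 /shortenP[p ep up _] ->.
exists (nth z (z :: p)), (size p); split => //.
- by rewrite (last_nth z).
- have /card_uniqP := up; have := max_card (mem (z :: p)).
  by move=> + E; rewrite E.
- by move=> i j ip jp /eqP; rewrite nth_uniq //= => /eqP.
- by move=> i ip; exact: (pathP z ep).
Qed.

Definition harmonic_number (n : nat) : R := \sum_(k < n) k.+1%:R^-1.

(** The constant 6 is the 3 of the grid times the 2 lost in comparing energies; [#|V| <= b] makes
    the grid fit in the support window. *)
Lemma cyl_resistance (f : V * int -> R) (b : nat) (z y : V) :
  connect e z y ->
  (forall v u, (b < `|u|)%N -> f (v, u) = 0) -> (#|V| <= b)%N ->
  (f (z, 0) - f (y, 0)) ^+ 2 <=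
  6 * (2 * harmonic_number #|V| + 1) *
    \sum_(k < (b + b).+1) \sum_v flux f (v, k%:Z - b%:Z).
Proof.
move=> /connected_path[x [D [<- <- DV x_inj x_path]]] f0 Vb.
have le1 := grid_resistance (fun i j => f (x i, j%:Z)) D.
have le2 := cyl_energy_le f0 x_inj x_path (leq_trans (ltnW DV) Vb).
have HD : \sum_(k < D) k.+1%:R^-1 <= harmonic_number #|V|.
  apply: (@sum_shift_le (fun k => k.+1%:R^-1) 0) => [k|]; last exact: ltnW.
  by rewrite invr_ge0.
have HD0 : 0 <= \sum_(k < D) k.+1%:R^-1 :> R.
  by apply: sumr_ge0 => k _; rewrite invr_ge0.
have E0 := grid_energy_ge0 (fun i j => f (x i, j%:Z)) D.
apply: (le_trans le1); nra.
Qed.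

(** * Visits to level 0 before hitting a point *)

Section Visits.
Variable y : V * int.

(* Expected number of visits to level 0 in [n] steps before hitting [y]. *)
Fixpoint visits (n : nat) (x : V * int) : R :=
  if n is k.+1 then
    if x == y then 0 else (x.2 == 0)%:R + avg (visits k) x
  else 0.

Lemma le_avg (f g : V * int -> R) (x : V * int) :
  (forall z, cyl_adj e x z -> f z <= g z) -> avg f x <= avg g x.
Proof.
case: x => v u le_fg; rewrite /avg ler_wpM2r ?invr_ge0 //=.
apply: lerD; first apply: lerD; try apply: ler_sum => w evw; apply: le_fg.
- by rewrite /cyl_adj /= eqxx opprD addNKr normrN1.
- by rewrite /cyl_adj /= eqxx opprB addrC subrK normr1.
- by rewrite /cyl_adj /= eqxx evw orbT.
Qed.

Lemma avg_cst (c : R) (x : V * int) : avg (fun=> c) x = c.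
Proof.
rewrite /avg sumr_const -[X in X + _]/(c *+ 2) -mulrnDr addnC.
by rewrite -[_ *+ _]mulr_natr mulfK // pnatr_eq0 addn2.
Qed.

Lemma avg_ge0 (f : V * int -> R) (x : V * int) :
  (forall z, 0 <= f z) -> 0 <= avg f x.
Proof. by move=> f0; rewrite -(avg_cst 0 x) le_avg. Qed.

Lemma visits_ge0 n x : 0 <= visits n x.
Proof.
elim: n x => [|n IHn] x //=; case: ifP => // _.
by rewrite addr_ge0 ?avg_ge0.
Qed.

Lemma visits_le n x : visits n x <= visits n.+1 x.
Proof.
elim: n x => [|n IHn] x; first exact: visits_ge0.
by rewrite [leLHS]/=  [leRHS]/=; case: ifP => // _; rewrite lerD2l le_avg.
Qed.

(** Only the times 0 to [n - 1] are counted, too few to reach level 0. This gives the finite support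
    that the resistance bound requires. *)
Lemma visits_far n v u : (n <= `|u|)%N -> visits n (v, u) = 0.
Proof.
elim: n v u => [|n IHn] v u nu //=; case: ifP => // _.
rewrite (_ : u == 0 = false) ?add0r; last by apply/eqP; lia.
rewrite /avg /= !IHn ?big1 ?addr0 ?mul0r //; try lia.
by move=> w _; rewrite IHn //; lia.
Qed.

(** Truncation at [n] turns the Green function equation into an inequality, by monotonicity in [n];
    at [y] the function vanishes. *)
Lemma flux_visits_le n x :
  flux (visits n) x <= (x.2 == 0)%:R * ((deg x.1 + 2)%:R * visits n x).
Proof.
rewrite /flux; case: (eqVneq x y) => [->|xy].
  have -> : visits n y = 0 by case: n => //= n; rewrite eqxx.
  by rewrite !(mulr0, mul0r).
rewrite [leRHS]mulrC ler_wpM2l ?mulr_ge0 ?visits_ge0 //.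
by have := visits_le n x; rewrite /= (negPf xy) lerBlDr.
Qed.

End Visits.

(* With [K] the maximum of [f = visits n] on level 0 and [r] the resistance,
   [K^2 <= r * energy f] and [energy f = <f, f - avg f> <= (total degree) * K]. *)
Lemma visits_level0_le (y : V) (d : nat) (n : nat) (z : V) :
  connected_graph e -> (max_degree e <= d)%N ->
  visits (y, 0) n (z, 0) <=
  6 * (2 * harmonic_number #|V| + 1) * ((d + 2)%:R * #|V|%:R).
Proof.
move=> e_conn le_d; pose f := visits (y, 0) n.
have f0 := visits_ge0 (y, 0) n.
pose zm := [arg max_(w > z | predT w) f (w, 0)]%O.
have zm_max w : f (w, 0) <= f (zm, 0).
  by rewrite /zm; case: arg_maxP => // i _; apply.
apply: (le_trans (zm_max z)); set K := f (zm, 0).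
pose b := (n + #|V|)%N.
have C0 : 0 <= 6 * (2 * harmonic_number #|V| + 1).
  have : 0 <= harmonic_number #|V| by apply: sumr_ge0 => k _; rewrite invr_ge0.
  lra.
have Kle : K ^+ 2 <=
    6 * (2 * harmonic_number #|V| + 1) * ((d + 2)%:R * #|V|%:R * K).
  have y0 : f (y, 0) = 0 by rewrite /f; case: (n) => //= k; rewrite eqxx.
  have -> : K = f (zm, 0) - f (y, 0) by rewrite y0 subr0.
  apply: le_trans (@cyl_resistance f b zm y (e_conn _ _) _ _) _.
  - by move=> v u bu; apply: visits_far; rewrite /b in bu; lia.
  - by rewrite leq_addl.
  apply: ler_wpM2l => //; rewrite y0 subr0 -/K.
  (* The index [b] stands for level 0; all other levels have flux at most 0. *)
  have blt : (b < (b + b).+1)%N by lia.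
  rewrite (bigD1 (Ordinal blt)) //= subrr.
  apply: (@le_trans _ _ (\sum_v flux f (v, 0))).
    rewrite gerDl; apply: sumr_le0 => k kb; apply: sumr_le0 => v _.
    apply: (le_trans (flux_visits_le (y, 0) n _)) => /=.
    rewrite (_ : k%:Z - b%:Z == 0 = false) ?mul0r //.
    by apply: contraNF kb; rewrite subr_eq0 => /eqP[kb]; apply/eqP/val_inj.
  apply: (le_trans (ler_sum _ (fun v _ => flux_visits_le (y, 0) n (v, 0)))).
  apply: (@le_trans _ _ (\sum_(v : V) (d + 2)%:R * K)).
    apply: ler_sum => v _; rewrite eqxx mul1r; apply: ler_pM => //.
    by rewrite ler_nat leq_add2r deg_le.
  by rewrite sumr_const -mulr_natl; lra.
have [K0|K0] := leP K 0.
  by apply: (le_trans K0); apply: mulr_ge0 => //; exact: mulr_ge0.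
by rewrite -(ler_pM2r K0) -expr2 -!mulrA; rewrite -!mulrA in Kle; exact: Kle.
Qed.
End DirichletForm.

(** * Supermartingale bounds *)

Section WalkExpectation.
Variables (R : realFieldType) (V : finType) (e : rel V).

Lemma avgD (f g : V * int -> R) x :
  avg e (fun z => f z + g z) x = avg e f x + avg e g x.
Proof. by rewrite /avg big_split /= -mulrDl; congr (_ / _); ring. Qed.

Lemma avgZ (c : R) (f : V * int -> R) x :
  avg e (fun z => c * f z) x = c * avg e f x.
Proof. by rewrite /avg -mulr_sumr; ring. Qed.

Lemma eq_avg (f g : V * int -> R) x : f =1 g -> avg e f x = avg e g x.
Proof. by move=> /funext ->. Qed.

(* Expectation of [Phi [:: X 0; ...; X n]] for the walk started at [x]. *)
Fixpoint path_mean (n : nat) (x : V * int) (Phi : seq (V * int) -> R) : R :=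
  if n is k.+1 then avg e (fun z => path_mean k z (fun s => Phi (x :: s))) x
  else Phi [:: x].

Lemma path_mean_le n x Phi Psi :
  (forall s, Phi s <= Psi s) -> path_mean n x Phi <= path_mean n x Psi.
Proof.
elim: n x Phi Psi => [|n IHn] x Phi Psi le_PP //=.
by apply: le_avg => z _; apply: IHn.
Qed.

Lemma path_meanD n x Phi Psi :
  path_mean n x (fun s => Phi s + Psi s) =
  path_mean n x Phi + path_mean n x Psi.
Proof.
elim: n x Phi Psi => [|n IHn] x Phi Psi //=.
by rewrite -avgD; apply: eq_avg => z; exact: IHn.
Qed.

Lemma path_meanZ c n x Phi :
  path_mean n x (fun s => c * Phi s) = c * path_mean n x Phi.
Proof.
elim: n x Phi => [|n IHn] x Phi //=.
by rewrite -avgZ; apply: eq_avg => z; exact: IHn.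
Qed.

Lemma path_mean_cst c n x : path_mean n x (fun=> c) = c.
Proof.
elim: n x => [|n IHn] x //=; rewrite -[RHS](avg_cst e c x).
by apply: eq_avg => z; exact: IHn.
Qed.

Lemma path_mean_sum (I : Type) (r : seq I) n x (Phi : I -> seq (V * int) -> R) :
  path_mean n x (fun s => \sum_(i <- r) Phi i s) =
  \sum_(i <- r) path_mean n x (Phi i).
Proof.
elim: r => [|i r IHr].
  rewrite big_nil -[RHS](path_mean_cst 0 n x); congr path_mean.
  by apply/funext => s; rewrite big_nil.
rewrite big_cons -IHr -path_meanD; congr path_mean.
by apply/funext => s; rewrite big_cons.
Qed.

(** A discrete Feynman-Kac functional: the mean of the product of [c] along the path. Its recursion
    turns supermartingale arguments into inductions on [n]. *)
Fixpoint mul_mean (c : V * int -> R) (n : nat) (x : V * int) : R :=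
  c x * (if n is k.+1 then avg e (mul_mean c k) x else 1).

Lemma path_mean_prod c n x :
  path_mean n x (fun s => \prod_(z <- s) c z) = mul_mean c n x.
Proof.
elim: n x => [|n IHn] x /=; first by rewrite big_seq1 mulr1.
rewrite -avgZ; apply: eq_avg => z; rewrite -IHn -path_meanZ; congr path_mean.
by apply/funext => s; rewrite big_cons.
Qed.

Lemma mul_mean_ge0 c n x : (forall z, 0 <= c z) -> 0 <= mul_mean c n x.
Proof.
move=> c0; elim: n x => [|n IHn] x /=; first by rewrite mulr1.
by rewrite mulr_ge0 // avg_ge0.
Qed.

Lemma mul_mean_le1 c n x : (forall z, 0 <= c z <= 1) -> mul_mean c n x <= 1.
Proof.
move=> c01; have c0 z : 0 <= c z by case/andP: (c01 z).
elim: n x => [|n IHn] x /=; first by rewrite mulr1; case/andP: (c01 x).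
rewrite -(mulr1 1) ler_pM ?avg_ge0 //.
- by move=> z; exact: mul_mean_ge0.
- by case/andP: (c01 x).
- by rewrite -(avg_cst e 1 x) le_avg.
Qed.

Lemma avg_height (g : int -> R) (v : V) (u : int) :
  avg e (fun z => g z.2) (v, u) =
  g u + (g (u + 1) + g (u - 1) - 2 * g u) / (deg e v + 2)%:R.
Proof.
have m0 : (deg e v + 2)%:R != 0 :> R by rewrite pnatr_eq0 addn2.
rewrite /avg /= sumr_const -mulr_natl -/(deg e v).
by rewrite natrD in m0 *; field; rewrite -natrD addnC natrD.
Qed.

Variable d : nat.
Hypothesis max_deg : (max_degree e <= d)%N.

(* [(H + 1)^2 - u^2] decreases by at least [2 / (d + 2)] per step on average,
   which bounds the mean exit time of [|u| < H]; then use Markov's inequality. *)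
Lemma exit_time_tail (H : R) (n : nat) (v : V) (u : int) : 0 < H ->
  `|u%:~R| <= H + 1 ->
  n.+1%:R * mul_mean (fun z => if `|z.2%:~R| < H then 1 else 0) n (v, u) <=
  (d + 2)%:R / 2 * ((H + 1) ^+ 2 - u%:~R ^+ 2).
Proof.
move=> H0.
have d2 : 2 <= (d + 2)%:R :> R by rewrite ler_nat addn2.
have G0 (w : R) : `|w| <= H + 1 -> 0 <= (H + 1) ^+ 2 - w ^+ 2.
  by rewrite ler_norml => /andP[? ?]; nra.
have G1 (w : R) : `|w| < H -> 1 <= (H + 1) ^+ 2 - w ^+ 2.
  by rewrite ltr_norml => /andP[? ?]; nra.
elim: n v u => [|n IHn] v u uH /=.
  rewrite mul1r mulr1; have [uh|_] := ltP; last first.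
    by rewrite mulr_ge0 ?G0 // divr_ge0.
  have := G1 _ uh; nra.
have [uh|_] := ltP; last first.
  by rewrite mul0r mulr0 mulr_ge0 ?G0 // divr_ge0.
rewrite mul1r -addn1 natrD mulrDl mul1r.
set t := mul_mean _ _.
have le1 : avg e t (v, u) <= 1.
  rewrite -(avg_cst e 1 (v, u)); apply: le_avg => z _; apply: mul_mean_le1 => w.
  by case: ifP; rewrite lexx ler01.
have le2 : n.+1%:R * avg e t (v, u) <=
    avg e (fun z => (d + 2)%:R / 2 * ((H + 1) ^+ 2 - z.2%:~R ^+ 2)) (v, u).
  rewrite -avgZ; apply: le_avg => -[v' u'] /= adj; apply: IHn.
  have : `|u' - u| <= 1.
    by case/orP: adj => /= /andP[/eqP ? /eqP ?]; lia.
  rewrite -(ler_int R) intr_norm rmorphB /= => h.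
  by rewrite -(subrK u%:~R u'%:~R) (le_trans (ler_normD _ _)) // addrC lerD // ltW.
apply: (le_trans (lerD le2 le1)).
(* The second difference of the parabola is -2, so the drift is [- (d + 2) / (deg + 2) <= -1], which
   pays for the extra unit of time. *)
rewrite (avg_height (fun k => (d + 2)%:R / 2 * ((H + 1) ^+ 2 - k%:~R ^+ 2))).
rewrite -addrA gerDl rmorphD rmorphB /=.
have m0 : 0 < (deg e v + 2)%:R :> R by rewrite ltr0n addn2.
rewrite -(ler_pM2r m0) mulrDl mulfVK ?gt_eqF // mul0r mul1r.
have : (deg e v + 2)%:R <= (d + 2)%:R :> R by rewrite ler_nat leq_add2r deg_le.
lra.
Qed.

(* With [L] visits to level 0, [(1 - 1/kappa)^L (|u| + kappa)] is a
   supermartingale, and it is at least [(1 - 1/kappa)^L (H + kappa)] once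
   [H <= |u|]. *)
Lemma few_visits_mean (kappa H : R) (n : nat) (v : V) (u : int) :
  1 <= kappa -> 0 < H ->
  mul_mean (fun z => if z.2 == 0 then 1 - kappa^-1 else 1) n (v, u) <=
  (`|u%:~R| + kappa) / (H + kappa) +
  mul_mean (fun z => if `|z.2%:~R| < H then 1 else 0) n (v, u).
Proof.
move=> k1 H0; set rho := (fun z => _); set t := (fun z => _).
have kV : kappa^-1 <= 1 by rewrite invf_le1 //; lra.
have kV0 : 0 < kappa^-1 by rewrite invr_gt0; lra.
have kk : kappa * kappa^-1 = 1 by rewrite mulfV //; lra.
have rho01 z : 0 <= rho z <= 1 by rewrite /rho; case: ifP => _; lra.
have Hk : 0 < H + kappa by lra.
have t0 k z : 0 <= mul_mean t k z by apply: mul_mean_ge0 => w; rewrite /t; case: ifP.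
have far m w k : H <= `|k%:~R| -> mul_mean rho m (w, k) <=
    (`|k%:~R| + kappa) / (H + kappa) + mul_mean t m (w, k).
  move=> Hle; apply: (le_trans (mul_mean_le1 m (w, k) rho01)).
  rewrite -[leLHS]addr0 lerD // ler_pdivlMr // mul1r; lra.
elim: n v u => [|n IHn] v u.
  have [/far//|uH] := leP H `|u%:~R|.
  rewrite /= !mulr1 /t /= uH; case/andP: (rho01 (v, u)) => _ le1.
  have : 0 <= (`|u%:~R| + kappa) / (H + kappa) by rewrite divr_ge0 ?addr_ge0 //; lra.
  lra.
have [/far//|uH] := leP H `|u%:~R|.
have tE : t (v, u) = 1 by rewrite /t /= uH.
rewrite /= tE mul1r.
have {}IHn : avg e (mul_mean rho n) (v, u) <=
    avg e (fun z => (`|z.2%:~R| + kappa) / (H + kappa)) (v, u) +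
    avg e (mul_mean t n) (v, u).
  by rewrite -avgD; apply: le_avg => -[v' u'] _; exact: IHn.
have T0 : 0 <= avg e (mul_mean t n) (v, u) by apply: avg_ge0.
case/andP: (rho01 (v, u)) => r0 r1.
suff : rho (v, u) * avg e (fun z => (`|z.2%:~R| + kappa) / (H + kappa)) (v, u)
    <= (`|u%:~R| + kappa) / (H + kappa) by nra.
rewrite (avg_height (fun k => (`|k%:~R| + kappa) / (H + kappa))) -!intr_norm.
(* At height 0 the mean of [|u| + kappa] rises to at most [kappa + 1], and
   [(1 - 1 / kappa) (kappa + 1) <= kappa]. Elsewhere [|u|] is harmonic. *)
rewrite /rho /=; case: eqP => [->|/eqP u0].
  rewrite normr0 add0r sub0r normrN1 normr1.
  have m2 : 2 <= (deg e v + 2)%:R :> R by rewrite ler_nat addn2.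
  have -> : (1%:~R + kappa) / (H + kappa) + (1%:~R + kappa) / (H + kappa)
      - 2 * (kappa / (H + kappa)) = 2 / (H + kappa) by ring.
  rewrite mulrAC -mulrDl mulrA ler_pM2r ?invr_gt0 //.
  have : 2 / (deg e v + 2)%:R <= 1 :> R by rewrite ler_pdivrMr ?mul1r //; lra.
  have : 0 <= 2 / (deg e v + 2)%:R :> R by rewrite divr_ge0.
  nra.
rewrite mul1r -!mulrDl; set X := (X in _ + X / _).
have -> : X = 0; last by rewrite mul0r addr0.
have : (`|u + 1| + `|u - 1| = 2 * `|u|)%R by lia.
move=> /(congr1 (fun k : int => k%:~R : R)).
rewrite rmorphD rmorphM /= => E; rewrite /X.
have -> : 2 * ((`|u|%:~R + kappa) / (H + kappa)) =
   (2%:~R * `|u|%:~R + 2 * kappa) / (H + kappa) by ring.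
by rewrite -E; ring.
Qed.

(* As in Khas'minskii's lemma: [w = 1 + visits / M] lies in [[1, 2]] on level 0
   and loses [1 / M >= w / (2 M)] at each visit there, so
   [w * (1 - 1 / (2 M)) ^ (- L)] is a supermartingale up to hitting [y]. *)
Lemma avoid_mean (y : V * int) (M : R) (n : nat) (x : V * int) : 1 <= M ->
  (forall k v, visits R e y k (v, 0) <= M) ->
  mul_mean (fun z => (z != y)%:R * (if z.2 == 0 then (1 - (2 * M)^-1)^-1 else 1))
    n x <= 1 + visits R e y n.+1 x / M.
Proof.
move=> M1 visM; set c := (fun z => _).
pose q := (2 * M)^-1.
have MV0 : 0 < M^-1 by rewrite invr_gt0; lra.
have qE : q = M^-1 / 2 by rewrite /q invfM mulrC.
have MV1 : M^-1 <= 1 by rewrite invf_le1 //; lra.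
have q1 : 0 < 1 - q by lra.
have c0 z : 0 <= c z by rewrite /c mulr_ge0 //; case: ifP => // _; rewrite invr_ge0 ltW.
(* One-step estimate shared by the base case and the induction step. *)
have step m z : (if m is k.+1 then avg e (mul_mean c k) z else 1) <=
    1 + avg e (visits R e y m) z / M -> mul_mean c m z <= 1 + visits R e y m.+1 z / M.
  move=> IH; have -> : mul_mean c m z =
    c z * (if m is k.+1 then avg e (mul_mean c k) z else 1) by case: (m).
  have visE : visits R e y m.+1 z =
    if z == y then 0 else (z.2 == 0)%:R + avg e (visits R e y m) z by [].
  apply: (le_trans (ler_wpM2l (c0 z) IH)).
  have v0 := visits_ge0 R e y m.+1 z.
  have w0 : 0 <= visits R e y m.+1 z / M by rewrite divr_ge0 //; lra.
  have wM : z.2 = 0 -> visits R e y m.+1 z / M <= 1.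
    move=> z0; rewrite ler_pdivrMr ?mul1r; [|lra].
    by rewrite (surjective_pairing z) z0; exact: visM.
  move: (visits R e y m.+1 z) visE v0 w0 wM => W visE v0 w0 wM.
  move: visE; rewrite /c; case: (z == y) => /= visE; first by rewrite !mul0r; lra.
  move: visE wM; case: eqP => [z0|_] visE wM; last first.
    by rewrite visE add0r !mul1r.
  have -> : avg e (visits R e y m) z = W - 1 by rewrite visE addrC addKr.
  rewrite mul1r mulrC -/q ler_pdivrMr // mulrBl mul1r.
  have := wM z0; rewrite qE; nra.
elim: n x => [|n IHn] x; apply: step.
  by rewrite lerDl divr_ge0 ?avg_ge0 //; lra.
apply: (le_trans (le_avg (g := fun z => 1 + visits R e y n.+1 z / M) _)) => //.
rewrite avgD avg_cst lerD2l.
rewrite (eq_avg _ (g := fun z => M^-1 * visits R e y n.+1 z)) ?avgZ 1?mulrC //.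
by move=> z; rewrite mulrC.
Qed.

Lemma bernoulli_le (q : R) (n : nat) : 0 <= q <= 1 -> 1 - n%:R * q <= (1 - q) ^+ n.
Proof.
move=> q01; elim: n => [|n IHn]; first by rewrite mul0r subr0.
have n0 : 0 <= n%:R :> R by [].
rewrite exprS -addn1 natrD; nra.
Qed.

(** * Probability of not covering level 0 *)

Definition covers (s : seq (V * int)) : bool := [forall y : V, (y, 0) \in s].

Lemma level0_count_prod (r : R) (s : seq (V * int)) :
  \prod_(z <- s) (if z.2 == 0 then r else 1) = r ^+ count (fun z => z.2 == 0) s.
Proof.
elim: s => [|z s IHs]; first by rewrite big_nil.
by rewrite big_cons IHs /=; case: ifP => _; rewrite ?mul1r // exprS.
Qed.

(** With [L] visits to level 0, either [L < l] and [rho ^ (L - l) >= 1], or some [y] is missed while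
    [theta ^ (l - L) >= 1]. Exponential weights replace the indicators so that the means become
    [mul_mean]. *)
Lemma not_covers_le (l : nat) (rho theta : R) (s : seq (V * int)) :
  0 < rho <= 1 -> 0 < theta <= 1 ->
  (~~ covers s)%:R <=
  rho ^- l * \prod_(z <- s) (if z.2 == 0 then rho else 1) +
  \sum_(y : V) theta ^+ l * \prod_(z <- s)
     ((z != (y, 0))%:R * (if z.2 == 0 then theta^-1 else 1)).
Proof.
move=> /andP[rho0 rho1] /andP[th0 th1].
have S0 : 0 <= \sum_(y : V) theta ^+ l * \prod_(z <- s)
     ((z != (y, 0))%:R * (if z.2 == 0 then theta^-1 else 1)).
  apply: sumr_ge0 => y _; rewrite mulr_ge0 ?exprn_ge0 ?(ltW th0) // prodr_ge0 // => z _.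
  by rewrite mulr_ge0 //; case: ifP => // _; rewrite invr_ge0 ltW.
rewrite level0_count_prod; set L := count _ s.
have A0 : 0 <= rho ^- l * rho ^+ L.
  by rewrite mulr_ge0 ?invr_ge0 ?exprn_ge0 // ltW.
have [|/forallPn[y ys]] /= := boolP (covers s); first by rewrite addr_ge0.
have [Ll|lL] := ltnP L l.
  rewrite -[leLHS]addr0 lerD // mulrC ler_pdivlMr ?exprn_gt0 // mul1r.
  exact: (ler_wiXn2l (ltW rho0) rho1 (ltnW Ll)).
rewrite -[leLHS]add0r lerD // (bigD1 y) //= -[leLHS]addr0 lerD //; last first.
  apply: sumr_ge0 => w _; rewrite mulr_ge0 ?exprn_ge0 ?(ltW th0) // prodr_ge0 // => z _.
  by rewrite mulr_ge0 //; case: ifP => // _; rewrite invr_ge0 ltW.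
have -> : \prod_(z <- s) ((z != (y, 0))%:R * (if z.2 == 0 then theta^-1 else 1)) =
    theta^-1 ^+ L.
  rewrite -level0_count_prod; apply: eq_big_seq => z zs.
  by rewrite (_ : z != _) ?mul1r //; apply: contraNneq ys => <-.
rewrite exprVn ler_pdivlMr ?exprn_gt0 // mul1r.
exact: (ler_wiXn2l (ltW th0) th1 lL).
Qed.

Lemma not_covers_mean (M H : R) (l n : nat) (x : V) :
  symmetric e -> connected_graph e ->
  1 <= M -> 0 < H -> (0 < l)%N ->
  6 * (2 * harmonic_number R #|V| + 1) * ((d + 2)%:R * #|V|%:R) <= M ->
  path_mean n (x, 0) (fun s => (~~ covers s)%:R) <=
  2 * (2 * l%:R / H + (d + 2)%:R * (H + 1) ^+ 2 / (2 * n.+1%:R)) +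
  2 * #|V|%:R * (1 - (2 * M)^-1) ^+ l.
Proof.
move=> e_sym e_conn M1 H0 l0 leM.
(* With [kappa = 2 l], Bernoulli's inequality gives [rho ^ l >= 1/2], so undoing the weight costs
   only a factor 2. *)
pose kappa : R := 2 * l%:R; pose rho := 1 - kappa^-1; pose theta := 1 - (2 * M)^-1.
have l1 : 1 <= l%:R :> R by rewrite ler1n.
have k2 : 2 <= kappa by rewrite /kappa; lra.
have kV : kappa^-1 <= 2^-1 by rewrite lef_pV2 ?posrE //; lra.
have kV0 : 0 < kappa^-1 by rewrite invr_gt0; lra.
have qV : (2 * M)^-1 <= 2^-1 by rewrite lef_pV2 ?posrE //; lra.
have qV0 : 0 < (2 * M)^-1 by rewrite invr_gt0; lra.
have rho01 : 0 < rho <= 1 by rewrite /rho; lra.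
have th01 : 0 < theta <= 1 by rewrite /theta; lra.
apply: (le_trans (path_mean_le n (x, 0) (fun s => not_covers_le l s rho01 th01))).
rewrite path_meanD path_meanZ path_mean_prod path_mean_sum; apply: lerD.
  have := few_visits_mean n x 0 (le_trans _ k2) H0; rewrite -/rho.
  set m := mul_mean _ n _; set t := mul_mean _ n _ => le_m.
  have {}le_m : m <= (`|0%:~R| + kappa) / (H + kappa) + t by apply: le_m; lra.
  have le_t : n.+1%:R * t <= (d + 2)%:R / 2 * ((H + 1) ^+ 2 - 0%:~R ^+ 2).
    by apply: exit_time_tail => //; rewrite mulr0z normr0; lra.
  have rl : rho ^- l <= 2.
    rewrite -[leRHS]invrK lef_pV2 ?posrE ?exprn_gt0 ?invr_gt0 //; last by case/andP: rho01.
    apply: le_trans (@bernoulli_le kappa^-1 l _); last by lra.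
    by rewrite /kappa invfM mulrCA mulfV ?mulr1; lra.
  have m0 : 0 <= m by apply: mul_mean_ge0 => z; case: ifP => _; lra.
  apply: (le_trans (ler_wpM2r m0 rl)); rewrite ler_pM2l //.
  apply: (le_trans le_m); apply: lerD.
    rewrite mulr0z normr0 add0r /kappa ler_pM2l ?lef_pV2 ?posrE //; lra.
  rewrite invfM mulrA ler_pdivlMr ?ltr0n // mulrC; apply: (le_trans le_t).
  by rewrite mulr0z expr0n subr0 mulrAC.
(* Union bound over [y]; the factor 2 bounds [1 + visits / M] on level 0. *)
apply: (@le_trans _ _ (\sum_(y : V) theta ^+ l * 2)).
  apply: ler_sum => y _; rewrite path_meanZ path_mean_prod.
  apply: ler_wpM2l; first by rewrite exprn_ge0 //; case/andP: th01 => /ltW.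
  have visM k v : visits R e (y, 0) k (v, 0) <= M.
    exact: (le_trans (visits_level0_le R e_sym y k v e_conn max_deg) leM).
  apply: (le_trans (avoid_mean n (x, 0) M1 visM)).
  have : visits R e (y, 0) n.+1 (x, 0) / M <= 1.
    by rewrite ler_pdivrMr ?mul1r; [exact: visM|lra].
  lra.
by rewrite sumr_const -[leLHS]mulr_natr -mulrA mulrC.
Qed.
End WalkExpectation.

(** * The law of the walk *)

Section CountableEvents.
Variables (d : measure_display) (Omega : measurableType d) (E : countType).

(** Since [E] is countable, the event is a countable union over the values of the first position,
    enumerated by [unpickle]. *)
Lemma measurable_traj (X : nat -> Omega -> E) :
  (forall n (A : set E), measurable (X n @^-1` A)) ->
  forall n k (Q : pred (seq E)),
  measurable [set w | Q [seq X i w | i <- iota k n]].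
Proof.
move=> mX; elim=> [|n IHn] k Q /=.
  case: (Q [::]); last by rewrite (_ : [set _ | _] = set0) //; apply/seteqP; split.
  by rewrite (_ : [set _ | _] = setT) //; apply/seteqP; split.
pose B m : set Omega := if unpickle m is Some z then
    X k @^-1` [set z] `&` [set w | Q (z :: [seq X i w | i <- iota k.+1 n])]
  else set0.
rewrite (_ : [set _ | _] = \bigcup_m B m).
  apply: bigcup_measurable => m _; rewrite /B; case: unpickle => [z|//].
  by apply: measurableI; [exact: mX|exact: (IHn _ (fun s => Q (z :: s)))].
apply/seteqP; split => w /=.
  by move=> Qw; exists (pickle (X k w)) => //; rewrite /B pickleK.
by case=> m _; rewrite /B; case: unpickle => [z|//] [/= ->].
Qed.

Lemma measure_split_seq (R : realType) (P : probability Omega R)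
    (Y : Omega -> E) (A : set Omega) (L : seq E) :
  (forall B : set E, measurable (Y @^-1` B)) -> measurable A -> uniq L ->
  P A = (\sum_(z <- L) P (A `&` Y @^-1` [set z])
         + P (A `&` Y @^-1` [set y | y \notin L]))%E.
Proof.
move=> mY mA; elim: L => [|z L IHL] /=.
  rewrite big_nil add0e => _; congr (P _); apply/seteqP.
  by split => w /=; [move=> Aw; split|case].
move=> /andP[zL /IHL ->]; rewrite big_cons -addeA addeCA; congr (_ + _)%E.
rewrite -measureU.
- congr (P _); apply/seteqP; split => w /=.
    case=> Aw YL; have [<-|yz] := eqVneq (Y w) z; [by left|right].
    by split=> //; rewrite inE negb_or yz.
  case=> -[Aw]; first by move=> ->.
  by rewrite inE negb_or => /andP[].
- exact: measurableI.
- exact: measurableI.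
- by apply/seteqP; split => // w [[_ /= ->] [_ /=]]; rewrite inE eqxx.
Qed.

End CountableEvents.

Section WalkLaw.
Variables (R : realType) (V : finType) (e : rel V).

Definition cyl_nbrs (x : V * int) : seq (V * int) :=
  [:: (x.1, x.2 + 1), (x.1, x.2 - 1)
    & [seq (v, x.2) | v <- enum [pred v | e x.1 v]]].

Lemma cyl_nbrs_uniq x : uniq (cyl_nbrs x).
Proof.
rewrite /= !inE; apply/and3P; split.
- apply/norP; split; first by rewrite xpair_eqE eqxx; apply/eqP; lia.
  by apply/negP => /mapP[v _ [_ ?]]; lia.
- by apply/negP => /mapP[v _ [_ ?]]; lia.
- by rewrite map_inj_uniq ?enum_uniq // => v1 v2 [].
Qed.

Lemma mem_cyl_nbrs x z : z \in cyl_nbrs x -> cyl_adj e x z.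
Proof.
case: z => w k; rewrite /cyl_adj !inE => /or3P[/eqP[-> ->]|/eqP[-> ->]|/mapP[v + [-> ->]]] /=.
- by rewrite eqxx opprD addNKr normrN1.
- by rewrite eqxx opprB addrC subrK normr1.
- by rewrite mem_enum inE => ->; rewrite eqxx orbT.
Qed.

(** Links [avg] to the transition probabilities that define the walk. *)
Lemma avg_step (f : V * int -> R) x :
  avg e f x = \sum_(z <- cyl_nbrs x) srw_step R (cyl_adj e) x z * f z.
Proof.
rewrite big_seq_cond (eq_bigr (fun z => (deg e x.1 + 2)%:R^-1 * f z)).
  rewrite -big_seq_cond -mulr_sumr mulrC /avg; congr (_ * _).
  by rewrite !big_cons big_map big_enum /= addrA.
move=> z /andP[/mem_cyl_nbrs adj _].
by rewrite /srw_step adj cyl_num_neighbors.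
Qed.

Variables (d : measure_display) (Omega : measurableType d).
Variables (P : probability Omega R) (X : nat -> Omega -> V * int) (x : V * int).
Hypothesis srwX : is_srw (cyl_adj e) x P X.

Let starts (k : nat) (s : nat -> V * int) : set Omega :=
  [set w | forall i, (i <= k)%N -> X i w = s i].

Let weight (k : nat) (s : nat -> V * int) : R :=
  (s 0%N == x)%:R * \prod_(i < k) srw_step R (cyl_adj e) (s i) (s i.+1).

Let extend (k : nat) (s : nat -> V * int) (z : V * int) : nat -> V * int :=
  fun i => if i == k.+1 then z else s i.

Let startsS k s z :
  starts k s `&` X k.+1 @^-1` [set z] = starts k.+1 (extend k s z).
Proof.
apply/seteqP; split => w /=.
  move=> [ws wz] i; rewrite leq_eqVlt /extend; case: eqP => [-> //|_] /=.
  by rewrite ltnS; exact: ws.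
move=> ws; split; last by rewrite ws // /extend eqxx.
by move=> i ik; rewrite ws ?(leqW ik) // /extend; case: eqP => // ?; lia.
Qed.

Let weightS k s z :
  weight k.+1 (extend k s z) = weight k s * srw_step R (cyl_adj e) (s k) z.
Proof.
rewrite /weight big_ord_recr /= /extend eqxx mulrA.
rewrite (_ : k == k.+1 = false); last by apply/eqP; lia.
congr (_ * _ * _); apply: eq_bigr => i _; have ik := ltn_ord i.
by rewrite !ifF //; apply/eqP; lia.
Qed.

Let measurable_starts k s : measurable (starts k s).
Proof.
rewrite (_ : starts k s =
  [set w | (fun t => t == [seq s i | i <- iota 0 k.+1]) [seq X i w | i <- iota 0 k.+1]]).
  exact: (measurable_traj (proj1 srwX) k.+1 0 (fun t => t == [seq s i | i <- iota 0 k.+1])).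
apply/seteqP; split => w /=.
  move=> ws; apply/eqP; apply: (iffLR (eq_in_map _ _ (iota 0 k.+1))) => i.
  by rewrite mem_iota => ik; apply: ws; lia.
move=> /eqP/(iffRL (eq_in_map _ _ (iota 0 k.+1))) ws i ik.
by apply: ws; rewrite mem_iota; lia.
Qed.

(** The transition probabilities to the listed neighbors sum to 1, so the extensions of the prefix
    by a neighbor already exhaust its probability. *)
Let leave_null k s :
  P (starts k s `&` X k.+1 @^-1` [set y | y \notin cyl_nbrs (s k)]) = 0%E.
Proof.
have [mX PX] := srwX.
have := measure_split_seq P (mX k.+1) (measurable_starts k s) (cyl_nbrs_uniq (s k)).
rewrite (eq_bigr (fun z => (weight k s * (srw_step R (cyl_adj e) (s k) z * 1))%:E)).
  rewrite sumEFin -mulr_sumr -avg_step avg_cst mulr1 [P (starts _ _)]PX -/(weight k s).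
  set N := _ `&` _; have NF : P N \is a fin_num.
    by apply: fin_num_measure; apply: measurableI => //; exact: mX.
  rewrite -(fineK NF) -EFinD => -[] /eqP; rewrite -subr_eq0 opprD addNKr oppr_eq0.
  by move=> /eqP ->.
by move=> z _; rewrite startsS mulr1 -weightS; exact: PX.
Qed.

(** The Markov property after a prescribed prefix, by induction on [n]: split according to the next
    position, the non-neighbors contributing 0. *)
Lemma starts_traj_prob n k s (Q : pred (seq (V * int))) :
  P (starts k s `&` [set w | Q [seq X i w | i <- iota k n.+1]]) =
  (weight k s * path_mean e n (s k) (fun t => (Q t)%:R))%:E.
Proof.
have [mX PX] := srwX.
elim: n k s Q => [|n IHn] k s Q /=.
  have [Qs|Qs] := boolP (Q [:: s k]).
    rewrite mulr1 -[RHS]PX; congr (P _); apply/seteqP; split => w /=; first by case.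
    by move=> ws; split => //; rewrite ws.
  rewrite mulr0 (_ : _ `&` _ = set0) ?measure0 //; apply/seteqP; split => // w /=.
  by case=> /(_ k (leqnn k)) ->; rewrite (negPf Qs).
have mQ := measurable_traj mX n.+2 k Q.
rewrite (measure_split_seq P (mX k.+1) (measurableI _ _ (measurable_starts k s) mQ)
  (cyl_nbrs_uniq (s k))).
rewrite [X in (_ + X)%E](_ : _ = 0%E).
  rewrite adde0 avg_step mulr_sumr -sumEFin; apply: eq_bigr => z _.
  rewrite mulrA -weightS.
  have {3}-> : z = extend k s z k.+1 by rewrite /extend eqxx.
  rewrite -(IHn k.+1 _ (fun t => Q (s k :: t))) -startsS; congr (P _).
  apply/seteqP; split => w /= [[ws h1] h2].
    by split; [split|rewrite -(ws k)].
  by split=> //; split=> //; rewrite (ws k).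
apply/eqP; rewrite eq_le measure_ge0 andbT -(leave_null k s) le_measure ?inE //.
- by apply: measurableI; [exact: measurableI|exact: mX].
- by apply: measurableI => //; exact: mX.
- by move=> w [[]].
Qed.

(** Take the prefix of length one and drop the event that the walk starts at [x]; a lower bound is
    all that is used below. *)
Lemma traj_prob_ge n (Q : pred (seq (V * int))) :
  ((path_mean e n x (fun t => (Q t)%:R))%:E <=
   P [set w | Q [seq X i w | i <- iota 0 n.+1]])%E.
Proof.
have [mX _] := srwX.
have := starts_traj_prob n 0 (fun=> x) Q.
rewrite /weight eqxx big_ord0 !mul1r => <-; apply: le_measure; rewrite ?inE.
- by apply: measurableI => //; exact: measurable_traj.
- exact: measurable_traj.
- by move=> w [].
Qed.
End WalkLaw.

(** * Disconnection and covering *)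

Section Disconnection.
Variables (V : finType) (e : rel V).
Hypothesis e_conn : connected_graph e.

Lemma joined_in_trans (A : set (V * int)) a b c :
  joined_in (cyl_adj e) A a b -> joined_in (cyl_adj e) A b c ->
  joined_in (cyl_adj e) A a c.
Proof.
move=> [p [pp <- pA]] [q [pq <- qA]]; exists (p ++ q); split.
- by rewrite cat_path pp.
- by rewrite last_cat.
- move=> z; rewrite -cat_cons mem_cat => /orP[/pA//|zq].
  by apply: qA; rewrite inE zq orbT.
Qed.

(** Move vertically above or below [v], then horizontally by connectedness of the base; [sgn] treats
    both ends at once. *)
Lemma joined_in_half (A : set (V * int)) (u sgn : int) (v w : V) (k : nat) :
  `|sgn| = 1 -> (forall z (i : nat), A (z, u + sgn * i%:Z)) ->
  joined_in (cyl_adj e) A (v, u) (w, u + sgn * k%:Z).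
Proof.
move=> sgn1 inA; apply: (@joined_in_trans _ _ (v, u + sgn * k%:Z)).
  elim: k => [|k IHk].
    rewrite mulr0 addr0; exists [::]; split=> // z; rewrite inE => /eqP ->.
    by have := inA v 0%N; rewrite mulr0 addr0.
  apply: (joined_in_trans IHk); exists [:: (v, u + sgn * k.+1%:Z)]; split=> //.
    rewrite /= andbT /cyl_adj /= eqxx /= (_ : _ - _ = - sgn) ?normrN ?sgn1 //.
    by rewrite -addn1 PoszD; ring.
  by move=> z; rewrite !inE => /orP[] /eqP ->.
have /connectP[p pp ->] := e_conn v w.
exists [seq (z, u + sgn * k%:Z) | z <- p]; split.
- elim: p v pp => [|z p IHp] v //= /andP[vz zp].
  by rewrite IHp // andbT /cyl_adj /= eqxx vz orbT.
- by rewrite (last_map (fun z => (z, u + sgn * k%:Z))).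
- move=> z; rewrite -(map_cons (fun z => (z, u + sgn * k%:Z))) => /mapP[z' _ ->].
  exact: inA.
Qed.

(** A discrete intermediate value theorem: a step changes the height by at most 1. *)
Lemma cyl_path_crosses0 (a : V * int) p : path (cyl_adj e) a p ->
  a.2 < 0 -> 0 < (last a p).2 -> exists2 z, z \in p & z.2 = 0.
Proof.
elim: p a => [|z p IHp] a /=; first by lia.
move=> /andP[az zp] a0 l0; have [z0|z0] := eqVneq z.2 0.
  by exists z; rewrite ?mem_head.
have {}z0 : z.2 < 0 by case/orP: az => /andP[/eqP ? h]; [move/eqP: h; lia|lia].
by have [t tp t0] := IHp z zp z0 l0; exists t; rewrite // inE tp orbT.
Qed.

(** Beyond the maximal height [m] of the trajectory both ends avoid the trace and are connected; a
    path between them would cross the covered level 0. *)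
Lemma level0_disconnects (x : nat -> V * int) n :
  @level0 V `<=` trace x n -> disconnects e (trace x n).
Proof.
move=> cov; pose v0 := (x 0%N).1.
pose m := (\max_(i < n.+1) `|(x i).2|%N)%N.
have le_m i : (i <= n)%N -> (`|(x i).2|%N <= m)%N.
  move=> ik; have ik' : (i < n.+1)%N by [].
  exact: (leq_bigmax (F := fun i : 'I_n.+1 => `|(x i).2|%N) (Ordinal ik')).
exists m.+1%:Z => M mM.
have out (z : V * int) : M <= `|z.2| -> (~` trace x n) z.
  by move=> Mz [i /= ik iz]; have := le_m i ik; rewrite iz; lia.
pose C (u : int) := [set b | joined_in (cyl_adj e) (~` trace x n) (v0, u) b].
have outM : (~` trace x n) (v0, M) by apply: out => /=; lia.
have outN : (~` trace x n) (v0, - M) by apply: out => /=; lia.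
exists (C M), (C (- M)); split.
- by exists (v0, M).
- by exists (v0, - M).
- move=> E; have : C M (v0, M).
    by exists [::]; split=> // z; rewrite inE => /eqP ->.
  rewrite E => -[p [pp pl pA]].
  have [||z zp z0] := cyl_path_crosses0 pp; rewrite ?pl /=; try lia.
  by apply: (pA z); [rewrite inE zp orbT|exact: cov].
- move=> [v u] /= Mu; have -> : u = M + 1 * (absz (u - M))%:Z by lia.
  by apply: joined_in_half => // z i; apply: out => /=; lia.
- move=> [v u] /= Mu; have -> : u = - M + (- 1) * (absz (u + M))%:Z by lia.
  by apply: joined_in_half => // z i; apply: out => /=; lia.
Qed.

Lemma disconnection_le_cover (R : realType) (x : nat -> V * int) :
  (disconnection_time e R x <= cover_time R x)%E.
Proof.
apply: ereal_inf_le_tmp => _ [n cov <-]; exists n => //.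
exact: level0_disconnects.
Qed.

(** Cover times are integers or infinite, so the real deadline [t] can be truncated. *)
Lemma cover_time_leP (R : realType) (x : nat -> V * int) (t : R) : 0 <= t ->
  (cover_time R x <= t%:E)%E <-> covers [seq x i | i <- iota 0 (Num.truncn t).+1].
Proof.
move=> t0; pose n := Num.truncn t.
have coversP : covers [seq x i | i <- iota 0 n.+1] <-> @level0 V `<=` trace x n.
  split=> [/forallP cov [v u] /= u0|cov].
    have /mapP[i] := cov v; rewrite mem_iota => /andP[_ ik] vi.
    by exists i => //=; rewrite -vi -u0.
  apply/forallP => v; have [i /= ik iv] := cov (v, 0) erefl.
  by rewrite -iv; apply: (@map_f _ _ x (iota 0 n.+1)); rewrite mem_iota add0n ltnS.
rewrite -/n coversP; split=> [le_t|cov]; last first.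
  apply: (@le_trans _ _ n%:R%:E); last by rewrite lee_fin truncn_le.
  by apply: ereal_inf_lbound; exists n.
apply/not_notP => ncov; move: le_t; apply/negP; rewrite -ltNge.
apply: (@lt_le_trans _ _ n.+1%:R%:E); first by rewrite lte_fin truncnS_gt.
apply: le_ereal_inf_tmp => _ [k cov <-]; rewrite lee_fin ler_nat ltnNge.
apply/negP => kn; apply: ncov => z z0; have [i /= ik <-] := cov z z0.
by exists i => //=; exact: leq_trans kn.
Qed.

End Disconnection.

(** * Asymptotics of the error terms *)

Section Asymptotics.
Variable R : realType.

(** Induction using [ln (1 - 1 / (n + 2)) <= - 1 / (n + 2)]. *)
Lemma harmonic_number_le (n : nat) : harmonic_number R n.+1 <= 1 + ln n.+1%:R.
Proof.
elim: n => [|n IHn]; first by rewrite /harmonic_number big_ord1 ln1 addr0 invr1.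
rewrite /harmonic_number big_ord_recr /=.
apply: (le_trans (lerD IHn (lexx _))); rewrite -addrA lerD2l.
have n1 : 0 < n.+1%:R :> R by rewrite ltr0n.
have n2 : 0 < n.+2%:R :> R by rewrite ltr0n.
have v1 : n.+2%:R^-1 < 1 :> R by rewrite invf_lt1 // ltr1n.
have := @le_ln1Dx R (- n.+2%:R^-1); rewrite ltrN2 => /(_ v1).
have -> : 1 - n.+2%:R^-1 = n.+1%:R / n.+2%:R :> R.
  apply: (mulIf (lt0r_neq0 n2)).
  by rewrite mulrBl mul1r mulVf ?divfK ?gt_eqF // -[n.+2%:R]natr1 addrK.
rewrite ln_div ?posrE //; move: (ln _) (ln _) (_^-1) => a b c; lra.
Qed.

(** The errors come from leaving [|u| < H] with few visits, from not leaving it in time, and from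
    the union bound. With the outer factors 2 they contribute [8 / K], [4 D / K] and [2 / K]. *)
Lemma error_bound (N L lam K D M T H : R) (l n : nat) :
  1 <= N -> 1 <= L -> ln N = L -> 2 <= D -> 1 <= K -> K <= N -> K <= lam ->
  60 * (2 * D) <= K ->
  M = 30 * D * N * L -> H = N * L ^+ 2 * lam ^+ 2 ->
  T = N ^+ 2 * L ^+ 4 * lam ^+ 6 -> T < n.+1%:R ->
  N * L ^+ 2 * lam <= l%:R <= 2 * (N * L ^+ 2 * lam) ->
  2 * (2 * l%:R / H + D * (H + 1) ^+ 2 / (2 * n.+1%:R)) +
  2 * N * (1 - (2 * M)^-1) ^+ l <= (10 + 4 * D) / K.
Proof.
move=> N1 L1 lnN D2 K1 KN Kl DK ME HE TE Tn /andP[l1 l2].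
have lam1 : 1 <= lam by lra.
have L2 : 1 <= L ^+ 2 by rewrite exprn_ege1.
have A1 : 1 <= N * L ^+ 2 by rewrite -(mulr1 1) ler_pM //; lra.
have lam2 : 1 <= lam ^+ 2 by rewrite exprn_ege1.
have H1 : 1 <= H by rewrite HE -(mulr1 1) ler_pM //; lra.
have T0 : 0 < T by rewrite TE !mulr_gt0 ?exprn_gt0 //; lra.
have lamV : lam^-1 <= K^-1 by rewrite lef_pV2 ?posrE //; lra.
have NV : N^-1 <= K^-1 by rewrite lef_pV2 ?posrE //; lra.
have lamV0 : 0 < lam^-1 by rewrite invr_gt0; lra.
have e1 : 2 * l%:R / H <= 4 / lam.
  rewrite ler_pdivrMr; last by lra.
  have -> : 4 / lam * H = 4 * (N * L ^+ 2 * lam).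
    by rewrite HE; field; rewrite gt_eqF //; lra.
  lra.
have e2 : D * (H + 1) ^+ 2 / (2 * n.+1%:R) <= 2 * D / lam.
  apply: (@le_trans _ _ (D * (4 * H ^+ 2) / (2 * T))).
    apply: ler_pM.
    - by rewrite mulr_ge0 ?sqr_ge0 //; lra.
    - by rewrite invr_ge0 mulr_ge0.
    - by rewrite ler_pM2l; [nra|lra].
    - by rewrite lef_pV2 ?posrE ?mulr_gt0 ?ltr0n // ler_pM2l // ltW.
  have -> : D * (4 * H ^+ 2) / (2 * T) = 2 * D / lam * lam^-1.
    rewrite HE TE; field; rewrite !gt_eqF //; lra.
  have lam1V : lam^-1 <= 1 by rewrite invf_le1 //; lra.
  rewrite -[leRHS]mulr1; apply: ler_wpM2l => //.
  by rewrite divr_ge0 //; lra.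
have e3 : N * (1 - (2 * M)^-1) ^+ l <= N^-1.
  have M60 : 60 <= 2 * M.
    have DNL : 1 <= D * N * L by rewrite !mulr_ege1 //; lra.
    have -> : 2 * M = 60 * (D * N * L) by rewrite ME; ring.
    lra.
  have q0 : 0 <= 1 - (2 * M)^-1.
    by rewrite subr_ge0 invf_le1; lra.
  have q1 : 1 - (2 * M)^-1 <= expR (- (2 * M)^-1) := expR_ge1Dx _.
  apply: (@le_trans _ _ (N * expR (- (2 * L)))); last first.
    rewrite expRN mulrC ler_pdivrMl ?expR_gt0 // -[2 * L]/(2%:R * L) expRM_natl.
    rewrite -lnN lnK ?posrE; last by lra.
    by rewrite expr2 mulfK // gt_eqF //; lra.
  rewrite ler_pM2l; last by lra.
  apply: (le_trans (lerXn2r l _ _ q1)); rewrite ?nnegrE ?expR_ge0 //.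
  rewrite -expRM_natl ler_expR mulrN lerN2 ler_pdivlMr; last by lra.
  apply: (le_trans _ l1).
  (* As [60 * (2 * D) <= K <= lam], the lower bound on [l] gives [l / (2 M) >= 2 L], so each point
     is missed with weight at most [N ^ (-2)]. *)
  have -> : 2 * L * (2 * M) = N * L ^+ 2 * (60 * (2 * D)) by rewrite ME; ring.
  rewrite ler_pM2l; lra.
have e4 : D / lam <= D / K by rewrite ler_pM2l //; lra.
have -> : (10 + 4 * D) / K = 10 * K^-1 + 4 * (D / K) by ring.
rewrite -(mulrA 2 N); move: e1 e2 e3 e4 lamV NV; rewrite -(mulrA 2 D).
move: (2 * l%:R / H) (D * _ / _) (N * _) (D / lam) (D / K) => a b c u w.
move: (lam^-1) (N^-1) (K^-1) => f g h. lra.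
Qed.

End Asymptotics.

Lemma cover_error_small (R : realType) (d0 : nat) (eps eta : R) :
  0 < eps -> 0 < eta ->
  exists n0 : nat, forall (V : finType) (e : rel V) (x : V),
    symmetric e -> connected_graph e -> (max_degree e <= d0)%N ->
    (n0 <= #|V|)%N ->
  path_mean e (Num.truncn (#|V|%:R ^+ 2 * (ln #|V|%:R) `^ (4 + eps))) (x, 0)
    (fun s => (~~ covers s)%:R) <= eta.
Proof.
move=> eps0 eta0; pose D : R := (d0 + 2)%:R.
have D2 : 2 <= D by rewrite ler_nat addn2.
pose K := 60 * (2 * D) + (10 + 4 * D) / eta.
have Keta0 : 0 < (10 + 4 * D) / eta by rewrite divr_gt0 //; lra.
have K1 : 1 <= K by rewrite /K; lra.
have Keta : (10 + 4 * D) / K <= eta.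
  have K0 : 0 < K by lra.
  by rewrite ler_pdivrMr // [eta * K]mulrC -ler_pdivrMr // /K; lra.
(* This threshold gives both [N >= K] and [ln N >= 1 + K ^ (6 / eps)], whence [lam >= K]. *)
exists (Num.truncn (expR (1 + K `^ (6 / eps)) + K)).+1 => V e x e_sym e_conn le_d Vn0.
have NV : expR (1 + K `^ (6 / eps)) + K <= #|V|%:R.
  by apply: (le_trans (ltW (truncnS_gt _))); rewrite ler_nat.
set N : R := #|V|%:R in NV *.
have expK : 1 <= expR (1 + K `^ (6 / eps)).
  by rewrite -expR0 ler_expR addr_ge0 ?powR_ge0.
pose L := ln N.
have LK : 1 + K `^ (6 / eps) <= L.
  rewrite /L -ler_expR lnK ?posrE; lra.
have L1 : 1 <= L by have := powR_ge0 K (6 / eps); lra.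
pose lam := L `^ (eps / 6).
have Klam : K <= lam.
  have -> : K = (K `^ (6 / eps)) `^ (eps / 6).
    rewrite -powRrM (_ : 6 / eps * (eps / 6) = 1) ?powRr1; first by [].
      by lra.
    by field; rewrite gt_eqF.
  by apply: ge0_ler_powR; rewrite ?nnegrE ?powR_ge0 ?divr_ge0 //; lra.
(* The exponent [eps / 6] in [lam] makes [lam ^ 6] equal to [L ^ eps]. *)
have TE : N ^+ 2 * L `^ (4 + eps) = N ^+ 2 * L ^+ 4 * lam ^+ 6.
  rewrite -mulrA powRD; last by apply/implyP => _; rewrite gt_eqF //; lra.
  congr (_ * (_ * _)); first by rewrite -powR_mulrn //; lra.
  rewrite /lam -powR_mulrn ?powR_ge0 // -powRrM; congr (_ `^ _); by field.
pose T := N ^+ 2 * L `^ (4 + eps); rewrite -/T.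
pose A := N * L ^+ 2 * lam.
have A1 : 1 <= A.
  by rewrite /A !mulr_ege1 ?exprn_ege1 //; lra.
pose l := (Num.truncn A).+1.
have lA : A <= l%:R <= 2 * A.
  have := truncn_itv (le_trans ler01 A1) => /andP[h1 h2].
  by rewrite /l (ltW h2) -natr1; lra.
pose M := 30 * D * N * L; pose H := N * L ^+ 2 * lam ^+ 2.
have N1 : 1 <= N by lra.
have KN : K <= N by lra.
have DK : 60 * (2 * D) <= K by rewrite /K; lra.
have err := error_bound N1 L1 erefl D2 K1 KN Klam DK (erefl M) (erefl H) TE
  (truncnS_gt T) lA.
apply: le_trans Keta; apply: le_trans err; apply: (not_covers_mean le_d) => //.
- by rewrite /M !mulr_ege1 //; lra.
- by rewrite /H !mulr_gt0 ?exprn_gt0 //; lra.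
- have [m Vm] : exists m, #|V| = m.+1.
    by exists #|V|.-1; rewrite prednK //; apply/card_gt0P; exists x.
  have hL : harmonic_number R #|V| <= 1 + L.
    by rewrite /L /N Vm; exact: harmonic_number_le.
  (* The 30 in [M] is enough because [2 (1 + L) + 1 <= 5 L] for [L >= 1]. *)
  have -> : M = 6 * (5 * L) * (D * N) by rewrite /M; ring.
  apply: ler_wpM2r; first by rewrite mulr_ge0 //; lra.
  lra.
Qed.

Theorem theorem1p2 (R : realType) (d0 : nat) (eps : R)
    (hd0 : (2 <= d0)%N) (heps : 0 < eps) :
  forall eta : R, 0 < eta ->
  exists n0 : nat,
  forall (V : finType) (e : rel V),
    symmetric e -> irreflexive e -> connected_graph e ->
    (2 <= #|V|)%N -> (max_degree e <= d0)%N -> (n0 <= #|V|)%N ->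
  forall (d : measure_display) (Omega : measurableType d)
    (P : V * int -> probability Omega R) (X : nat -> Omega -> V * int),
    (forall x, is_srw (cyl_adj e) x (P x) X) ->
    ((1 - eta)%:E <=
      ereal_inf
        [set P x [set w |
             (disconnection_time e R (fun n => X n w)
                <= cover_time R (fun n => X n w)
                <= (#|V|%:R ^+ 2 * (ln #|V|%:R) `^ (4 + eps))%:E)%E]
        | x in @level0 V])%E.
Proof.
move=> eta eta0; have [n0 small] := cover_error_small d0 heps eta0.
exists n0 => V e e_sym _ e_conn _ le_d Vn0 d Omega P X srwX.
set T := _ * _ `^ _.
have T0 : 0 <= T by rewrite mulr_ge0 ?sqr_ge0 ?powR_ge0.
apply: le_ereal_inf_tmp => _ [[v u] /= u0 <-].
(* Disconnection never comes after covering, so the event reduces to covering by the truncated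
   deadline. *)
rewrite (_ : [set w | _] =
  [set w | covers [seq X i w | i <- iota 0 (Num.truncn T).+1]]); last first.
  apply/seteqP; split => w /=.
    by move=> /andP[_] /(cover_time_leP _ T0).
  by move=> cov; rewrite disconnection_le_cover //; apply/cover_time_leP.
have := traj_prob_ge (srwX (v, u)) (Num.truncn T) (@covers V).
apply: le_trans; rewrite lee_fin lerBlDr.
have := small V e v e_sym e_conn le_d Vn0; rewrite -/T -u0 => le_eta.
apply: (le_trans _ (lerD (lexx _) le_eta)); rewrite -path_meanD.
rewrite -[leLHS](path_mean_cst e 1 (Num.truncn T) (v, u)).
by apply: path_mean_le => s; case: covers; rewrite ?addr0 ?add0r.
Qed.
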